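(* Let $u$ be a univariate linear functional supported on the unit circle $\mathbb T$, let $L(z)=L_nz^n+\dots+L_{-n}z^{-n}$ ($n\ge1$, $L_nL_{-n}\ne0$) be a prepared Laurent polynomial with reciprocal $L_*$, and let $\hat u=L(z)u$, where the Gram matrices of $u$ and $\hat u$ are quasidefinite. Then, for $l\ge2n$, whenever the involved quasideterminants make sense (i.e. their top-left $2n\times2n$ blocks are invertible), $$\hat\phi_{1,l}(z)=\frac{L_{(-1)^ln}}{L(z)}\Theta_*\begin{bmatrix}\mathcal J^L_{\phi_{1,l}}&\phi_{1,l}(z)\\ \vdots&\vdots\\ \mathcal J^L_{\phi_{1,l+2n}}&\phi_{1,l+2n}(z)\end{bmatrix}=\overline{\frac{\overline{\hat H_l}}{\overline{L_{(-1)^{l+1}n}}}\Theta_*\begin{bmatrix}\mathcal J^{L_*}_{\phi_{2,l+1}}&0\\ \vdots&\vdots\\ \mathcal J^{L_*}_{\phi_{2,l+2n-1}}&0\\ \mathcal J^{L_*}_{\phi_{2,l+2n}}&1\\ \mathcal J^{L_*}_{\overline{K^{[l+1]}}}(\bar z)&0\end{bmatrix}},$$ $$\hat H_l=L_{(-1)^ln}H_l\,\Theta_*\begin{bmatrix}\mathcal J^L_{\phi_{1,l}}&1\\ \mathcal J^L_{\phi_{1,l+1}}&0\\ \vdots&\vdots\\ \mathcal J^L_{\phi_{1,l+2n}}&0\end{bmatrix}=\overline{\overline{L_{(-1)^{l+1}n}}\;\overline{H_l}\;\Theta_*\begin{bmatrix}\mathcal J^{L_*}_{\phi_{2,l}}&1\\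 \mathcal J^{L_*}_{\phi_{2,l+1}}&0\\ \vdots&\vdots\\ \mathcal J^{L_*}_{\phi_{2,l+2n}}&0\end{bmatrix}},$$ $$\overline{\hat\phi_{2,l}(z)}=\frac{\hat H_l}{L_{(-1)^ln}}\Theta_*\begin{bmatrix}\mathcal J^L_{\phi_{1,l+1}}&0\\ \vdots&\vdots\\ \mathcal J^L_{\phi_{1,l+2n-1}}&0\\ \mathcal J^L_{\phi_{1,l+2n}}&1\\ \mathcal J^L_{K^{[l+1]}}(\bar z)&0\end{bmatrix}=\overline{\frac{\overline{L_{(-1)^{l+1}n}}}{L_*(z)}\Theta_*\begin{bmatrix}\mathcal J^{L_*}_{\phi_{2,l}}&\phi_{2,l}(z)\\ \vdots&\vdots\\ \mathcal J^{L_*}_{\phi_{2,l+2n}}&\phi_{2,l+2n}(z)\end{bmatrix}}.$$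
   Context: Indices start at $0$. For a Laurent polynomial $F$, $\overline F(z):=\overline{F(\bar z)}$ and $F_*(z):=\overline F(z^{-1})$. $L_{(-1)^ln}$ is $L_n$ for $l$ even and $L_{-n}$ for $l$ odd. CMV sequence: $\chi(z)=[1,z^{-1},z,z^{-2},z^2,\dots]^\top$. $u$ is a (continuous) linear functional on $\mathbb C[z,z^{-1}]$ supported on $\mathbb T$, so that $\bar z=z^{-1}$ inside the pairing; $\langle f,g\rangle_u=\langle u_z,f(z)\overline{g(z)}\rangle=\langle u_z,f(z)g_*(z)\rangle$. The perturbed functional is $\langle\hat u,f\rangle=\langle u,Lf\rangle$. Gram matrix: $G_{k,l}=\langle\chi^{(k)},\chi^{(l)}\rangle_u$; quasidefinite means all leading principal minors are nonzero; then $G=S_1^{-1}H(S_2^{-1})^\dagger$ uniquely with $S_a$ lower unitriangular, $H=\operatorname{diag}(H_0,H_1,\dots)$ with nonzero entries; $\phi_a=S_a\chi=[\phi_{a,0},\phi_{a,1},\dots]^\top$, $K^{[l]}(\bar z_1,z_2)=\sum_{k=0}^{l-1}\overline{\phi_{2,k}(z_1)}H_k^{-1}\phi_{1,k}(z_2)$. $\hat H_k,\hat\phi_{1,k},\hat\phi_{2,k}$ are the corresponding objects for $\hat u$. If a Laurent polynomial $M$ has zeros $\eta_1,\dots,\eta_d\in\mathbb C\setminus\{0\}$ with multiplicities $m_1,\dots,m_d$, then $\mathcal J^M_f=[f(\eta_1),f'(\eta_1),\dots,\frac{f^{(m_1-1)}(\eta_1)}{(m_1-1)!},\dots,f(\eta_d),\dots,\frac{f^{(m_d-1)}(\eta_d)}{(m_d-1)!}]$.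 $\mathcal J^L_{K^{[l]}}(\bar z)$ is the jet of $x\mapsto K^{[l]}(\bar z,x)$ and $\mathcal J^{L_*}_{\overline{K^{[l]}}}(\bar z)$ is the jet of $x\mapsto\overline{K^{[l]}(\bar x,z)}$. Quasideterminant: $\Theta_*\begin{bmatrix}A&B\\C&D\end{bmatrix}=D-CA^{-1}B$ ($A$ square invertible, $B$ column, $C$ row, $D$ scalar). *)

(* Defs.v *)
From HB Require Import structures.
From mathcomp Require Import all_boot all_order all_algebra.
From mathcomp Require Import finmap complex reals.
From mathcomp Require Export monalg.

Set Implicit Arguments.
Unset Strict Implicit.
Unset Printing Implicit Defensive.

Import Order.TTheory GRing.Theory Num.Theory.
Local Open Scope ring_scope.

(* The C-vector space C[z, z^-1]: finitely supported coefficient families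
   indexed by int; [f@_k] is the coefficient of z^k and [<< c *g k >>] is the
   monomial c z^k.  The ring structure of monalg is not available for exponents
   in int (it requires a monoid without nontrivial units), so the
   multiplication is given by the same formula below. *)
Notation laurent C := {malg C[int]}.

Section Laurent.
Variable C : numClosedFieldType.
Implicit Types (f g M : laurent C) (z : C) (s : seq (C * nat)).

Definition lmul f g : laurent C :=
  \sum_(i <- msupp f) \sum_(j <- msupp g) << f@_i * g@_j *g i + j >>.

Definition leval f z : C := mmap idfun (fun k : int => z ^ k) f.

Definition lderiv f : laurent C :=
  \sum_(k <- msupp f) << f@_k *~ k *g k - 1 >>.

(* f_*(z) = conj (f (1 / conj z)), i.e. the coefficient of z^k is conj f_{-k}. *)
Definition lstar f : laurent C := \sum_(k <- msupp f) << (f@_k)^* *g - k >>.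

Definition taylor f z (j : nat) : C := leval (iter j lderiv f) z / (j`!)%:R.

(* [s] lists the zeros of [M] in C \ {0}, each once and paired with its
   multiplicity. *)
Definition zeros_mult M s : Prop :=
  [/\ uniq (unzip1 s),
      forall p, p \in s ->
        [/\ p.1 != 0, (0 < p.2)%N,
            forall j, (j < p.2)%N -> leval (iter j lderiv M) p.1 = 0
          & leval (iter p.2 lderiv M) p.1 != 0]
    & forall z, z != 0 -> leval M z = 0 -> z \in unzip1 s].

Definition jet s f : seq C :=
  flatten [seq [seq taylor f p.1 j | j <- iota 0 p.2] | p <- s].

(* When the multiplicities in [s] add up to [N], [jet s f] has size [N] and
   the default value of nth is never used. *)
Definition jet_row N s f : 'rV[C]_N := \row_(j < N) nth 0 (jet s f) j.

Definition jet_mx N s (phi : nat -> laurent C) (l : nat) : 'M[C]_N :=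
  \matrix_(i < N) jet_row N s (phi (l + i)%N).

Definition quasidet N (A : 'M[C]_N) (B : 'cV[C]_N) (c : 'rV[C]_N) (d : C) : C :=
  d - (c *m invmx A *m B) ord0 ord0.

Definition prepared (n : nat) M : Prop :=
  [/\ (1 <= n)%N,
      forall k : int, (n%:Z < `|k|)%R -> M@_k = 0
    & M@_(n%:Z) * M@_(- n%:Z) != 0].

(* L_{(-1)^a n} *)
Definition ext_coef M (n a : nat) : C := M@_((-1) ^+ a * n%:Z).

Definition chi_exp (k : nat) : int :=
  if odd k then - (uphalf k)%:Z else (k./2)%:Z.

Definition chi (k : nat) : laurent C := << chi_exp k >>.

Definition pairing (u : laurent C -> C) f g : C := u (lmul f (lstar g)).

Definition perturb M (u : laurent C -> C) : laurent C -> C :=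
  fun f => u (lmul M f).

Definition infmx := nat -> nat -> C.
Implicit Types (G S T : infmx).

Definition gram (u : laurent C -> C) : infmx :=
  fun k l => pairing u (chi k) (chi l).

Definition quasidefinite G : Prop :=
  forall k : nat, \det (\matrix_(i < k, j < k) G i j) != 0.

Definition lower_unitri S : Prop :=
  forall i, S i i = 1 /\ forall j, (i < j)%N -> S i j = 0.

(* The product of a lower triangular semi-infinite matrix with another one:
   all entries are finite sums. *)
Definition lower_mul S T : infmx :=
  fun i j => \sum_(k < i.+1) S i k * T k j.

Definition infmx1 : infmx := fun i j => (i == j)%:R.

Definition inverse_lower S T : Prop :=
  [/\ lower_unitri T, lower_mul S T =2 infmx1 & lower_mul T S =2 infmx1].

(* G = S1^-1 H (S2^-1)^dagger *)
Definition gauss_borel G S1 S2 (H : nat -> C) : Prop :=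
  [/\ lower_unitri S1, lower_unitri S2, forall k, H k != 0
    & exists T1 T2 : infmx,
        [/\ inverse_lower S1 T1, inverse_lower S2 T2
          & forall i j, G i j = \sum_(k < i.+1) T1 i k * H k * (T2 j k)^*]].

(* The entries of S chi, for S lower triangular. *)
Definition cmv_poly S (k : nat) : laurent C := \sum_(i < k.+1) S k i *: chi i.

(* x |-> K^[l](conj z, x) as a Laurent polynomial in x. *)
Definition cd_kernel S1 S2 (H : nat -> C) (l : nat) z : laurent C :=
  \sum_(k < l)
    ((leval (cmv_poly S2 k) z)^* * (H k)^-1) *: cmv_poly S1 k.

(* x |-> conj (K^[l](conj x, z)) as a Laurent polynomial in x. *)
Definition cd_kernel_conj S1 S2 (H : nat -> C) (l : nat) z : laurent C :=
  \sum_(k < l)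
    (((H k)^-1)^* * (leval (cmv_poly S1 k) z)^*) *: cmv_poly S2 k.

End Laurent.

(* Main.v *)
Require Import Defs.
From HB Require Import structures.
From mathcomp Require Import all_boot all_order all_algebra.
From mathcomp Require Import finmap complex reals.
From mathcomp Require Import zify ring.
Import Order.TTheory GRing.Theory Num.Theory.
Local Open Scope ring_scope.
Set Implicit Arguments.
Unset Strict Implicit.
Unset Printing Implicit Defensive.

(** Order the monomials as in the CMV sequence.  Multiplication by [L] raises
    the CMV degree by exactly [2n], and the leading coefficient gets multiplied
    by [L_{(-1)^l n}] ([cmv_below_lmul], [coef_lmul_top]).  Moreover it converts
    orthogonality for the perturbed pairing into orthogonality for the original
    one, since the perturbed pairing of [f] and [g] is the original pairing of
    [L f] and [g].  Writing [N = 2n], two consequences follow.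

    - [L phi1h_l - L_{(-1)^l n} phi1_{l+N}] has CMV degree below [l+N] and is
      orthogonal to [phi2_k] for [k < l].
    - If [K] and [Kh] are the reproducing kernels at a point [z] of the span of
      the first [l+1] monomials, for the original and the perturbed pairing,
      then [L Kh - K] has CMV degree at most [l+N], and it is orthogonal to that
      span, because both terms reproduce the (conjugated) value at [z].

    So in either case there is an equation [L p = r + h] with [r] explicit and
    [h = sum_(i < N) b_i phi1_(m+i)], for [m = l] or [m = l+1].  The jet of
    [L p] at the zeros of [L] vanishes, which yields the linear system
    [b A = - J_r] where the rows of [A] are the jets of the [phi1_(m+i)].  If
    [A] is invertible, [b] is known, and each linear functional [theta] takes on
    [h] the value [sum_i b_i theta(phi1_(m+i))], which is a quasideterminant
    whose last column consists of the [theta(phi1_(m+i))]: this is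
    [residual_quasidet].

    Three choices of [theta] produce three formulas: evaluation at [z]
    ([christoffel_first]), pairing with [phi2_l] ([christoffel_norm]) and the
    top CMV coefficient ([christoffel_second]).  These are proved for an
    arbitrary sesquilinear form, so that they apply also to the adjoint form,
    for which the roles of the two biorthogonal families are exchanged, the
    norms are conjugated and [L] is replaced by its reciprocal [lstar L].  This
    yields the remaining three formulas. *)

(** * The algebra of Laurent polynomials *)

Section LaurentAlgebra.
Variable C : numClosedFieldType.
Implicit Types (f g h M : laurent C) (z c : C) (k : int).

Lemma laurent_ind (P : laurent C -> Prop) :
  P 0 -> (forall f g, P f -> P g -> P (f + g)) ->
  (forall c k, P << c *g k >>) -> forall f, P f.
Proof.
by move=> P0 PD PU f; rewrite (monalgE f); apply: big_ind => // i _; apply: PU.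
Qed.

(** The enlarged index set [d] lets products with different supports on the left
    be compared term by term. *)
Lemma coef_lmulw (d : {fset int}) f g k : (msupp f `<=` d)%fset ->
  (lmul f g)@_k = \sum_(i <- d) f@_i * g@_(k - i).
Proof.
move=> led; rewrite /lmul raddf_sum /=.
have E i : (\sum_(j <- msupp g) << f@_i * g@_j *g i + j >>)@_k = f@_i * g@_(k - i).
  rewrite [in RHS](monalgE g) !raddf_sum /= mulr_sumr.
  apply: eq_bigr => j _; rewrite !mcoeffU mulrnAr.
  by congr (_ *+ _); congr nat_of_bool; apply/eqP/eqP; lia.
under eq_bigr do rewrite E.
apply: big_fset_incl => // i _ /mcoeff_outdom ->; exact: mul0r.
Qed.

Lemma coef_lmul f g k : (lmul f g)@_k = \sum_(i <- msupp f) f@_i * g@_(k - i).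
Proof. exact: coef_lmulw. Qed.

Lemma lmul_linear f : linear (lmul f).
Proof.
move=> c g h; apply/malgP => k; rewrite mcoeffD mcoeffZ !coef_lmul mulr_sumr.
by rewrite -big_split; apply: eq_bigr => i _; rewrite mcoeffD mcoeffZ mulrDr mulrCA.
Qed.
HB.instance Definition _ f :=
  GRing.isLinear.Build C (laurent C) (laurent C) _ (lmul f) (lmul_linear f).

Lemma lmulDl f g h : lmul (f + g) h = lmul f h + lmul g h.
Proof.
apply/malgP => k; rewrite mcoeffD.
rewrite (coef_lmulw _ _ (msuppD_le f g)).
rewrite (coef_lmulw _ _ (fsubsetUl (msupp f) (msupp g))).
rewrite (coef_lmulw _ _ (fsubsetUr (msupp f) (msupp g))).
by rewrite -big_split; apply: eq_bigr => i _; rewrite mcoeffD mulrDl.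
Qed.

Lemma lmulDr f g h : lmul f (g + h) = lmul f g + lmul f h.
Proof. exact: linearD. Qed.

Lemma lmul0r f : lmul f 0 = 0.
Proof. exact: linear0. Qed.

Lemma lmul0l h : lmul 0 h = 0.
Proof. by apply: (addIr (lmul 0 h)); rewrite -lmulDl !add0r. Qed.

Lemma lmulU c d i j : lmul << c *g i >> << d *g j >> = << c * d *g i + j >> :> laurent C.
Proof.
apply/malgP => k; rewrite (coef_lmulw _ _ msuppU_le) big_seq_fset1 !mcoeffU eqxx.
by rewrite mulr1n mulrnAr; congr (_ *+ _); congr nat_of_bool; apply/eqP/eqP; lia.
Qed.

(** The ring identities are multilinear, so [laurent_ind] reduces each of them to
    monomials. *)
Lemma lmulC f g : lmul f g = lmul g f.
Proof.
elim/laurent_ind: f => [|f1 f2 I1 I2|c i]; first by rewrite lmul0l lmul0r.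
  by rewrite lmulDl I1 I2 lmulDr.
elim/laurent_ind: g => [|g1 g2 I1 I2|d j]; first by rewrite lmul0l lmul0r.
  by rewrite lmulDl lmulDr I1 I2.
by rewrite !lmulU mulrC addrC.
Qed.

Lemma lmulA f g h : lmul f (lmul g h) = lmul (lmul f g) h.
Proof.
elim/laurent_ind: f => [|f1 f2 I1 I2|c i]; first by rewrite !lmul0l.
  by rewrite !lmulDl I1 I2.
elim/laurent_ind: g => [|f1 f2 I1 I2|d j]; first by rewrite !(lmul0r, lmul0l).
  by rewrite !(lmulDr, lmulDl) I1 I2.
elim/laurent_ind: h => [|f1 f2 I1 I2|e k]; first by rewrite !lmul0r.
  by rewrite !lmulDr I1 I2.
by rewrite !lmulU mulrA addrA.
Qed.

Lemma coef_lstar f k : (lstar f)@_k = (f@_(- k))^*.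
Proof.
rewrite [in RHS](monalgE f) /lstar !raddf_sum /=.
apply: eq_bigr => j _; rewrite !mcoeffU rmorphMn.
by congr (_ *+ _); congr nat_of_bool; apply/eqP/eqP; lia.
Qed.

Lemma lstarD f g : lstar (f + g) = lstar f + lstar g.
Proof. by apply/malgP => k; rewrite mcoeffD !coef_lstar mcoeffD rmorphD. Qed.

Lemma lstarZ c f : lstar (c *: f) = c^* *: lstar f.
Proof. by apply/malgP => k; rewrite mcoeffZ !coef_lstar mcoeffZ rmorphM. Qed.

Lemma lstar0 : lstar 0 = 0 :> laurent C.
Proof. by apply/malgP => k; rewrite coef_lstar !mcoeff0 conjC0. Qed.

Lemma lstarU c k : lstar << c *g k >> = << c^* *g - k >> :> laurent C.
Proof.
apply/malgP => j; rewrite coef_lstar !mcoeffU rmorphMn.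
by congr (_ *+ _); congr nat_of_bool; apply/eqP/eqP; lia.
Qed.

Lemma lstarK : involutive (@lstar C).
Proof. by move=> f; apply/malgP => k; rewrite !coef_lstar opprK conjCK. Qed.

Lemma lstar_lmul f g : lstar (lmul f g) = lmul (lstar f) (lstar g).
Proof.
elim/laurent_ind: f => [|f1 f2 I1 I2|c i]; first by rewrite !(lstar0, lmul0l).
  by rewrite !(lmulDl, lstarD) I1 I2.
elim/laurent_ind: g => [|g1 g2 I1 I2|d j]; first by rewrite !(lstar0, lmul0r).
  by rewrite !(lmulDr, lstarD) I1 I2.
by rewrite !(lmulU, lstarU) rmorphM opprD.
Qed.

Lemma coef_lderiv f k : (lderiv f)@_k = f@_(k + 1) *~ (k + 1).
Proof.
rewrite [in RHS](monalgE f) /lderiv !raddf_sum /= mulrz_suml.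
apply: eq_bigr => j _; rewrite !mcoeffU.
have -> : (j - 1 == k) = (j == k + 1) by apply/eqP/eqP; lia.
by case: eqP => [->//|_]; rewrite mul0rz.
Qed.

Lemma lderiv_linear : linear (@lderiv C).
Proof.
move=> c f g; apply/malgP => k; rewrite mcoeffD mcoeffZ !coef_lderiv.
by rewrite mcoeffD mcoeffZ mulrzDl mulrzAr.
Qed.
HB.instance Definition _ :=
  GRing.isLinear.Build C (laurent C) (laurent C) _ (@lderiv C) lderiv_linear.

Lemma lderivD f g : lderiv (f + g) = lderiv f + lderiv g.
Proof. exact: linearD. Qed.

Lemma lderiv0 : lderiv 0 = 0 :> laurent C.
Proof. exact: linear0. Qed.

Lemma lderivU c k : lderiv << c *g k >> = << c *~ k *g k - 1 >> :> laurent C.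
Proof.
apply/malgP => j; rewrite coef_lderiv !mcoeffU.
have -> : (k - 1 == j) = (k == j + 1) by apply/eqP/eqP; lia.
by case: eqP => [->//|_]; rewrite mul0rz.
Qed.

Lemma lderiv_lmul f g : lderiv (lmul f g) = lmul (lderiv f) g + lmul f (lderiv g).
Proof.
elim/laurent_ind: f => [|f1 f2 I1 I2|c i].
- by rewrite lderiv0 !lmul0l lderiv0 addr0.
- by rewrite lderivD !lmulDl lderivD I1 I2 addrACA.
elim/laurent_ind: g => [|g1 g2 I1 I2|d j].
- by rewrite lderiv0 !lmul0r lderiv0 addr0.
- by rewrite lderivD !lmulDr lderivD I1 I2 addrACA.
rewrite !(lmulU, lderivU, lmulU) /=.
have -> : i - 1 + j = i + j - 1 by ring.
have -> : i + (j - 1) = i + j - 1 by ring.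
by rewrite -monalgUD mulrzAl mulrzAr -mulrzDr.
Qed.

Lemma leval_scalar z : scalar (fun f => leval f z).
Proof.
move=> c f g; rewrite /leval raddfD /=; congr (_ + _).
rewrite (mmapEw (msuppZ_le c f)) mmapE mulr_sumr.
by apply: eq_bigr => i _; rewrite mcoeffZ mulrA.
Qed.

Lemma levalD f g z : leval (f + g) z = leval f z + leval g z.
Proof. exact: raddfD. Qed.

Lemma leval0 z : leval 0 z = 0 :> C.
Proof. exact: raddf0. Qed.

Lemma levalU c k z : leval << c *g k >> z = c * z ^ k.
Proof. exact: mmapU. Qed.

(** Multiplicativity fails at [z = 0], where the negative powers of the variable
    are zero by convention. *)
Lemma leval_lmul f g z : z != 0 -> leval (lmul f g) z = leval f z * leval g z.
Proof.
move=> z0.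
elim/laurent_ind: f => [|f1 f2 I1 I2|c i].
- by rewrite lmul0l leval0 mul0r.
- by rewrite lmulDl !levalD I1 I2 mulrDl.
elim/laurent_ind: g => [|g1 g2 I1 I2|d j].
- by rewrite lmul0r leval0 mulr0.
- by rewrite lmulDr !levalD I1 I2 mulrDr.
by rewrite lmulU !levalU expfzDr // mulrACA.
Qed.

Lemma taylor_scalar z j : scalar (fun f => taylor f z j).
Proof.
move=> c f g; rewrite /taylor mulrA -mulrDl; congr (_ / _).
elim: j f g => [|j IH] f g /=; first exact: leval_scalar.
by rewrite -!iterS !iterSr linearP IH.
Qed.

End LaurentAlgebra.

(** * Jets at the zeros of a multiple *)

Section Jets.
Variable C : numClosedFieldType.
Implicit Types (f g h M : laurent C) (z c : C) (k : int) (s : seq (C * nat)).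

(** Lists the pairs (point, order) independently of [f], so that each entry of a
    jet is visibly linear in [f]. *)
Lemma jetE s f :
  jet s f = [seq taylor f q.1 q.2
            | q <- flatten [seq [seq (p.1, j) | j <- iota 0 p.2] | p <- s]].
Proof.
rewrite /jet map_flatten -map_comp; congr flatten.
by apply: eq_map => p /=; rewrite -map_comp.
Qed.

Lemma jet_row_linear N s : linear (@jet_row C N s).
Proof.
move=> c f g; apply/rowP => j; rewrite !mxE !jetE.
set qs := flatten _; have [lt_j | ge_j] := ltnP j (size qs).
  by rewrite !(nth_map (0, 0%N)) // taylor_scalar.
by rewrite !nth_default ?size_map // mulr0 addr0.
Qed.
HB.instance Definition _ N s :=
  GRing.isLinear.Build C (laurent C) 'rV[C]_N _ (@jet_row C N s)
    (@jet_row_linear N s).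

(** By induction on [j], generalizing over both factors: the Leibniz rule writes
    the first derivative of a product as a sum of two products, to each of which
    the induction hypothesis applies. *)
Lemma leval_iter_lderiv_lmul j M f z : z != 0 ->
    (forall i, (i <= j)%N -> leval (iter i (@lderiv C) M) z = 0) ->
  leval (iter j (@lderiv C) (lmul M f)) z = 0.
Proof.
move=> z0; elim: j M f => [|j IH] M f HM.
  by rewrite /= leval_lmul // (HM 0%N) // mul0r.
rewrite iterSr lderiv_lmul.
have -> (a b : laurent C) :
    iter j (@lderiv C) (a + b) = iter j (@lderiv C) a + iter j (@lderiv C) b.
  by elim: (j) => //= i ->; rewrite lderivD.
rewrite levalD !IH ?addr0 //.
  by move=> i le_i; rewrite HM // ltnW.
by move=> i le_i; rewrite -iterSr HM.
Qed.

(** The total multiplicity of [s] may differ from [N]: entries of the jet beyond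
    its length are zero by convention, and those within it are zero since [M]
    vanishes to the prescribed orders. *)
Lemma jet_row_lmul_eq0 N s M f : zeros_mult M s -> jet_row N s (lmul M f) = 0.
Proof.
case=> _ zM _; apply/rowP => j; rewrite !mxE jetE.
set qs := flatten _; have [lt_j | ge_j] := ltnP j (size qs); last first.
  by rewrite nth_default ?size_map.
rewrite (nth_map (0, 0%N)) //; move: (mem_nth (0, 0%N) lt_j).
move: (nth _ qs j) => q /allpairsPdep[p [i [p_s]]].
rewrite mem_iota add0n => /andP[_ lt_i] -> /=; have [p0 _ pM _] := zM p p_s.
rewrite /taylor leval_iter_lderiv_lmul ?mul0r // => i' le_i'.
by apply: pM; apply: leq_ltn_trans lt_i.
Qed.

End Jets.

(** * The CMV enumeration of exponents *)

Lemma chi_expE j : chi_exp j = (-1) ^+ j * (uphalf j)%:Z.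
Proof.
rewrite /chi_exp -signr_odd; case: ifP => oj; first by rewrite mulN1r.
by rewrite mul1r uphalf_half oj.
Qed.

Lemma chi_exp_inj : injective chi_exp.
Proof. by move=> i j; rewrite /chi_exp; case: ifP; case: ifP; lia. Qed.

Lemma chi_exp_surj k : exists j, chi_exp j = k.
Proof.
exists (if (0 <= k)%R then `|k|%N * 2 else (`|k|%N * 2).-1)%N.
by rewrite /chi_exp; case: ifP; case: ifP; lia.
Qed.

(** A shift of the exponent by at most [n] lowers the CMV position by at most
    [2n].  The bound is attained only by the extreme shift whose sign is that of
    the exponent: this is why the coefficient [ext_coef], with its alternating
    sign, governs leading terms. *)
Lemma chi_exp_sub (j m n : nat) (i : int) :
    (`|i| <= n%:Z)%R -> (m + 2 * n <= j)%N ->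
  exists2 j', chi_exp j' = chi_exp j - i &
    (m <= j')%N /\ (j' = m -> i = (-1) ^+ j * n%:Z).
Proof.
move=> le_i le_j; have [j' E] := chi_exp_surj (chi_exp j - i).
exists j' => //; rewrite -signr_odd; move: E; rewrite /chi_exp.
by case: (boolP (odd j)) => oj; case: ifP => oj' E;
   rewrite /= ?expr1 ?expr0; split; lia.
Qed.

(** * Degrees in the CMV order *)

Section CMVOrder.
Variable C : numClosedFieldType.
Implicit Types (f g h M : laurent C) (c : C) (phi : nat -> laurent C).

(** Membership in the span of the first [m] monomials of the CMV sequence. *)
Definition cmv_below m f := forall j, (m <= j)%N -> f@_(chi_exp j) = 0.

Definition cmv_unitri phi :=
  forall k, (phi k)@_(chi_exp k) = 1 /\ cmv_below k.+1 (phi k).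

Lemma cmv_belowD m f g : cmv_below m f -> cmv_below m g -> cmv_below m (f + g).
Proof. by move=> bf bg j lj; rewrite mcoeffD bf // bg // addr0. Qed.

Lemma cmv_belowZ m c f : cmv_below m f -> cmv_below m (c *: f).
Proof. by move=> bf j lj; rewrite mcoeffZ bf // mulr0. Qed.

Lemma cmv_below_widen m m' f : (m <= m')%N -> cmv_below m f -> cmv_below m' f.
Proof. by move=> le_m bf j lj; apply: bf; apply: leq_trans lj. Qed.

Lemma cmv_below0 f : cmv_below 0 f -> f = 0.
Proof.
by move=> bf; apply/malgP => k; have [j <-] := chi_exp_surj k; rewrite bf ?mcoeff0.
Qed.

Lemma cmv_belowSP m f : cmv_below m.+1 f -> f@_(chi_exp m) = 0 -> cmv_below m f.
Proof. by move=> bf fm j; rewrite leq_eqVlt => /orP[/eqP<-//|/bf]. Qed.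

Lemma cmv_below_sum m r (F : nat -> laurent C) :
  (forall k, (k < r)%N -> cmv_below m (F k)) -> cmv_below m (\sum_(k < r) F k).
Proof. by move=> bF j lj; rewrite raddf_sum big1 // => k _; apply: bF. Qed.

(** Gaussian elimination from the top: subtracting the leading coefficient times
    [phi m] lowers the CMV degree. *)
Lemma cmv_unitri_expand phi m f : cmv_unitri phi -> cmv_below m f ->
  exists a : nat -> C, f = \sum_(k < m) a k *: phi k.
Proof.
move=> Uphi; elim: m f => [|m IH] f bf.
  by exists (fun=> 0); rewrite big_ord0; apply: cmv_below0.
have [phim bphi] := Uphi m.
have [|a E] := IH (f - f@_(chi_exp m) *: phi m).
  apply: cmv_belowSP; last by rewrite mcoeffB mcoeffZ phim mulr1 subrr.
  by rewrite -scaleNr; apply: cmv_belowD => //; apply: cmv_belowZ.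
exists (fun k => if k == m then f@_(chi_exp m) else a k).
rewrite big_ord_recr /= eqxx; apply/eqP; rewrite -subr_eq E; apply/eqP.
by apply: eq_bigr => k _; rewrite ltn_eqF.
Qed.

Lemma coef_unitri_sum phi m (a : nat -> C) : cmv_unitri phi ->
  (\sum_(k < m.+1) a k *: phi k)@_(chi_exp m) = a m.
Proof.
move=> Uphi; have [phim _] := Uphi m.
rewrite big_ord_recr mcoeffD mcoeffZ phim mulr1 -[RHS]add0r; congr (_ + _).
rewrite raddf_sum big1 // => k _; have [_ bk] := Uphi k.
by rewrite /= mcoeffZ bk ?mulr0.
Qed.

Lemma coef_chi k j : (chi C k)@_(chi_exp j) = (k == j)%:R.
Proof. by rewrite mcoeffU (inj_eq chi_exp_inj). Qed.

Lemma cmv_poly_unitri (S : infmx C) : lower_unitri S -> cmv_unitri (cmv_poly S).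
Proof.
move=> US k; have Uchi : cmv_unitri (chi C).
  by move=> i; split=> [|j lt_ij]; rewrite coef_chi ?eqxx // ltn_eqF.
split; first by rewrite /cmv_poly (coef_unitri_sum _ (S k)); have [] := US k.
apply: (@cmv_below_sum _ _ (fun i => S k i *: chi C i)) => i lt_i.
apply: cmv_belowZ.
by apply: cmv_below_widen (proj2 (Uchi i)).
Qed.

Variables (n : nat) (M : laurent C).
Hypothesis suppM : forall k : int, (n%:Z < `|k|)%R -> M@_k = 0.

Lemma msupp_le i : i \in msupp M -> (`|i| <= n%:Z)%R.
Proof. by rewrite -mcoeff_neq0 leNgt; apply: contraNN => /suppM/eqP. Qed.

(** In the convolution formula for the coefficient at position [j >= m + 2n], each
    term involves a coefficient of [f] at a position [>= m]. *)
Lemma cmv_below_lmul m f :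
  cmv_below m f -> cmv_below (m + 2 * n) (lmul M f).
Proof.
move=> bf j le_j; rewrite coef_lmul big_seq big1 // => i /msupp_le le_i.
have [j' <- [le_j' _]] := chi_exp_sub le_i le_j.
by rewrite bf // mulr0.
Qed.

(** By [chi_exp_sub] a single term of the convolution survives, the one with the
    extreme exponent of [M] whose sign is that of [chi_exp m]. *)
Lemma coef_lmul_top m f : cmv_below m.+1 f ->
  (lmul M f)@_(chi_exp (m + 2 * n)) = ext_coef M n m * f@_(chi_exp m).
Proof.
move=> bf; pose i0 : int := (-1) ^+ m * n%:Z.
(* The extreme exponent need not lie in the support of [M]; add it. *)
rewrite (coef_lmulw _ _ (fsubsetUr [fset i0]%fset (msupp M))).
rewrite (big_fsetD1 i0) /=; last by rewrite !inE eqxx.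
rewrite [X in _ + X]big1_seq ?addr0.
  congr (_ * f@__); rewrite !chi_expE /i0 exprD [(-1) ^+ (2 * n)]exprM.
  by rewrite sqrrN !expr1n mulr1 -mulrBr; congr (_ * _); lia.
move=> i /andP[_]; rewrite !inE => /andP[ne_i].
rewrite (negPf ne_i) => /msupp_le le_i.
have [j' E [le_j' Ej]] := chi_exp_sub le_i (leqnn (m + 2 * n)).
rewrite -E bf ?mulr0 // ltn_neqAle le_j' andbT.
apply: contraNneq ne_i => /esym/Ej ->.
by rewrite /i0 exprD [(-1) ^+ (2 * n)]exprM sqrrN !expr1n mulr1.
Qed.

End CMVOrder.

(** * Biorthogonal families for a sesquilinear form *)

Section Forms.
Variable C : numClosedFieldType.
Implicit Types (f g h M : laurent C) (c : C) (phi psi : nat -> laurent C).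
Implicit Types (theta : laurent C -> C) (pr : laurent C -> laurent C -> C).

(** Phrased through conjugates so that the condition is manifestly stable under
    taking adjoints. *)
Definition sesquilinear pr :=
  (forall g, scalar (pr^~ g)) /\ (forall f, scalar (fun g => (pr f g)^*)).

Definition biorthogonal pr phi psi (H : nat -> C) :=
  forall j k, pr (phi j) (psi k) = (j == k)%:R * H j.

Lemma scalarB theta f g : scalar theta -> theta (f - g) = theta f - theta g.
Proof. by move=> lin; rewrite -scaleN1r addrC lin mulN1r addrC. Qed.

Lemma scalarZ theta c f : scalar theta -> theta (c *: f) = c * theta f.
Proof.
move=> lin; have th0 : theta 0 = 0 by rewrite -(subrr 0) scalarB // subrr.
by rewrite -[c *: f]addr0 lin th0 addr0.
Qed.

Lemma scalar_sum theta m (a : nat -> C) (F : nat -> laurent C) : scalar theta ->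
  theta (\sum_(k < m) a k *: F k) = \sum_(k < m) a k * theta (F k).
Proof.
move=> lin; elim: m => [|m IH]; last by rewrite !big_ord_recr /= addrC lin IH addrC.
by rewrite !big_ord0 -[0 in LHS](scale0r 0) scalarZ // mul0r.
Qed.

Lemma sesquilinear_sumr pr f m (a : nat -> C) (F : nat -> laurent C) :
    sesquilinear pr ->
  pr f (\sum_(k < m) a k *: F k) = \sum_(k < m) (a k)^* * pr f (F k).
Proof.
case=> _ lin; apply: (can_inj (@conjCK C)); rewrite (scalar_sum _ _ _ (lin f)).
by rewrite rmorph_sum; apply: eq_bigr => k _; rewrite rmorphM /= conjCK.
Qed.

Lemma sum_delta m (F : nat -> C) k : (k < m)%N ->
  \sum_(j < m) (k == j :> nat)%:R * F j = F k.
Proof.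
move=> lt_k; rewrite (bigD1 (Ordinal lt_k)) //= eqxx mul1r big1 ?addr0 // => j ne.
rewrite (_ : (k == j :> nat) = false) ?mul0r //.
by apply: contraNF ne => /eqP e; apply/eqP/val_inj.
Qed.

Section Biorthogonal.
Variables (pr : laurent C -> laurent C -> C).
Variables (phi psi : nat -> laurent C) (H : nat -> C).
Hypotheses (Lpr : sesquilinear pr) (Opr : biorthogonal pr phi psi H).
Hypotheses (Uphi : cmv_unitri phi) (Upsi : cmv_unitri psi).
Hypothesis H_neq0 : forall k, H k != 0.

Lemma biorthogonal_below l g : cmv_below l.+1 g ->
  pr (phi l) g = (g@_(chi_exp l))^* * H l.
Proof.
move=> /(cmv_unitri_expand Upsi)[b ->]; rewrite coef_unitri_sum // sesquilinear_sumr //.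
under eq_bigr => k _ do rewrite Opr mulrCA.
by rewrite (sum_delta (fun k => (b k)^* * H l)).
Qed.

(** Pairing the expansion of [f] along [phi] with [psi k] isolates its [k]-th
    coefficient. *)
Lemma orthogonal_expand m N f :
    cmv_below (m + N) f -> (forall k, (k < m)%N -> pr f (psi k) = 0) ->
  exists b : nat -> C, f = \sum_(i < N) b i *: phi (m + i)%N.
Proof.
move=> /(cmv_unitri_expand Uphi)[a ->] Of; exists (fun i => a (m + i)%N).
rewrite big_split_ord /= [X in X + _]big1 ?add0r // => k _.
have := Of k (ltn_ord k); rewrite (scalar_sum _ _ _ (Lpr.1 _)) /=.
under eq_bigr => j _ do rewrite Opr eq_sym mulrCA.
rewrite (sum_delta (fun j => a j * H j)) ?ltn_addr // => /eqP.
by rewrite mulf_eq0 (negPf (H_neq0 k)) orbF => /eqP ->; rewrite scale0r.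
Qed.

(** The Christoffel-Darboux kernel, for families that need not come from
    matrices; stated so, it covers both families of a biorthogonal pair. *)
Definition reproducing_kernel l z : laurent C :=
  \sum_(k < l) ((leval (psi k) z)^* * (H k)^-1) *: phi k.

Lemma reproducing_kernel_below l z : cmv_below l (reproducing_kernel l z).
Proof.
apply: (cmv_below_sum
  (F := fun k => ((leval (psi k) z)^* * (H k)^-1) *: phi k)) => k lt_k.
by apply: cmv_belowZ; apply: cmv_below_widen (proj2 (Uphi k)).
Qed.

Lemma reproducing_kernelP l z g : cmv_below l g ->
  pr (reproducing_kernel l z) g = (leval g z)^*.
Proof.
move=> /(cmv_unitri_expand Upsi)[b ->]; rewrite sesquilinear_sumr //.
rewrite (scalar_sum _ _ _ (leval_scalar z)) rmorph_sum /=.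
apply: eq_bigr => k _; rewrite rmorphM; congr (_ * _).
rewrite (scalar_sum _ (fun k => (leval (psi k) z)^* * (H k)^-1) _ (Lpr.1 _)) /=.
under eq_bigr => j _ do rewrite Opr eq_sym mulrCA.
rewrite (sum_delta (fun j => (leval (psi j) z)^* / H j * H j)) //.
by rewrite mulfVK.
Qed.

(** The mechanism behind all the formulas.  Taking jets in [lmul M p = r + h]
    determines the coefficients of [h] along [phi m], ..., [phi (m + N - 1)], as
    the left-hand side has zero jet; applying [theta] then gives the product of
    this row of coefficients and the column of the values of [theta], which is
    what a quasideterminant with last entry [0] computes. *)
Lemma residual_quasidet N s M p r h m theta : zeros_mult M s ->
    lmul M p = r + h -> cmv_below (m + N) h ->
    (forall k, (k < m)%N -> pr h (psi k) = 0) -> scalar theta ->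
    jet_mx N s phi m \in unitmx ->
  theta h = quasidet (jet_mx N s phi m) (\col_(i < N) theta (phi (m + i)%N))
              (jet_row N s r) 0.
Proof.
move=> zM Mp bh Oh lin uA; have [b Eh] := orthogonal_expand bh Oh.
pose bv : 'rV[C]_N := \row_i b i.
have bA : jet_row N s r = - (bv *m jet_mx N s phi m).
  apply/eqP; rewrite -addr_eq0; apply/eqP.
  transitivity (jet_row N s (lmul M p)); last exact: jet_row_lmul_eq0.
  rewrite Mp linearD; congr (_ + _); rewrite Eh linear_sum mulmx_sum_row.
  by apply: eq_bigr => i _; rewrite linearZ mxE rowK.
rewrite /quasidet bA !mulNmx mulmxK // sub0r 2!mxE opprK Eh.
rewrite (scalar_sum _ _ (fun i => phi (m + i)%N) lin).
by apply: eq_bigr => i _; rewrite !mxE.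
Qed.

End Biorthogonal.

(** The entry [(a, b)] of [S1 G S2^dagger] is the pairing of the two polynomials,
    and the factorization turns it into the entry of [S1 T1 H (S2 T2)^dagger],
    which is diagonal. *)
Lemma gauss_borel_biorthogonal pr (S1 S2 : infmx C) H : sesquilinear pr ->
    gauss_borel (fun i j => pr (chi C i) (chi C j)) S1 S2 H ->
  biorthogonal pr (cmv_poly S1) (cmv_poly S2) H.
Proof.
move=> Lpr [_ _ _ [T1 [T2 [[LT1 ST1 _] [LT2 ST2 _] G]]]] a b.
rewrite /cmv_poly sesquilinear_sumr //.
under eq_bigr => j _ do rewrite (scalar_sum _ _ _ (Lpr.1 _)) mulr_sumr /=.
pose K := (a + b).+1.
(* Entries of the triangular [T1] above the diagonal vanish, so all the sums
   defining [G] can be given the same length, and then exchanged. *)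
have GK i j : (i <= a)%N ->
    pr (chi C i) (chi C j) =
      \sum_(k < K) T1 i k * H k * (T2 j k)^*.
  move=> le_i; rewrite G.
  rewrite (big_ord_widen K (fun k => T1 i k * H k * (T2 j k)^*)); last by lia.
  rewrite [RHS](bigID (fun k : 'I_K => (k < i.+1)%N)) /= [X in _ + X]big1 ?addr0 // => k.
  by rewrite -leqNgt => lt_k; rewrite (proj2 (LT1 i)) // !mul0r.
transitivity (\sum_(k < K) (lower_mul S1 T1 a k * (lower_mul S2 T2 b k)^*) * H k).
  rewrite exchange_big /= /lower_mul.
  under [RHS]eq_bigr => k _ do rewrite rmorph_sum mulr_suml mulr_suml.
  rewrite [RHS]exchange_big /=; apply: eq_bigr => i _.
  under [RHS]eq_bigr => k _ do rewrite mulr_sumr mulr_suml.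
  rewrite [RHS]exchange_big /=; apply: eq_bigr => j _.
  have le_i : (i <= a)%N by rewrite -ltnS.
  rewrite GK // !mulr_sumr; apply: eq_bigr => k _.
  by rewrite rmorphM /=; ring.
under eq_bigr => k _ do rewrite ST1 ST2 /infmx1 rmorph_nat -mulrA.
rewrite (sum_delta (fun k => (b == k)%:R * H k)) 1?eq_sym //.
by rewrite /K; lia.
Qed.

(** * Perturbation of a biorthogonal pair *)

Section Perturbed.
Variables (pr : laurent C -> laurent C -> C).
Variables (phi psi : nat -> laurent C) (H : nat -> C).
Hypotheses (Lpr : sesquilinear pr) (Opr : biorthogonal pr phi psi H).
Hypotheses (Uphi : cmv_unitri phi) (Upsi : cmv_unitri psi).
Hypothesis H_neq0 : forall k, H k != 0.

Variables (prh : laurent C -> laurent C -> C).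
Variables (phih psih : nat -> laurent C) (Hh : nat -> C).
Hypotheses (Lprh : sesquilinear prh) (Oprh : biorthogonal prh phih psih Hh).
Hypotheses (Uphih : cmv_unitri phih) (Upsih : cmv_unitri psih).
Hypothesis Hh_neq0 : forall k, Hh k != 0.

Variables (n : nat) (M : laurent C) (s : seq (C * nat)).
Hypothesis prep : prepared n M.
Hypothesis prhE : forall f g, prh f g = pr (lmul M f) g.
Hypothesis zM : zeros_mult M s.
Let N := (2 * n)%N.

Let N_gt0 : (0 < N)%N. Proof. by have [? _ _] := prep; rewrite muln_gt0. Qed.
Let suppM : forall k : int, (n%:Z < `|k|)%R -> M@_k = 0.
Proof. by case: prep. Qed.

Lemma ext_coef_neq0 a : ext_coef M n a != 0.
Proof.
case: prep => _ _; rewrite mulf_eq0 negb_or /ext_coef -signr_odd => /andP[Mn MNn].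
by case: (odd a); rewrite ?mulN1r // mul1r.
Qed.

Section FirstFamily.
Variable l : nat.
(* The multiple of [phi (l + N)] with the same leading term as [M phih_l]. *)
Let r := ext_coef M n l *: phi (l + N)%N.
Let h := lmul M (phih l) - r.

Let Mphih : lmul M (phih l) = r + h. Proof. by rewrite addrC subrK. Qed.

Let h_below : cmv_below (l + N) h.
Proof.
have [phi1 bphi] := Uphi (l + N)%N; have [phih1 bphih] := Uphih l.
apply: cmv_belowSP.
  rewrite /h /r -scaleNr; apply: cmv_belowD; last exact: cmv_belowZ.
  by have := cmv_below_lmul suppM bphih; rewrite addSn.
by rewrite mcoeffB mcoeffZ coef_lmul_top // phih1 phi1 subrr.
Qed.

(** The value at [k = l] carries the new norm, and is what [christoffel_norm]
    reads off. *)
Let pr_h k : (k <= l)%N -> pr h (psi k) = (k == l)%:R * Hh l.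
Proof.
move=> le_k; rewrite (scalarB _ _ (Lpr.1 _)) /r (scalarZ _ _ (Lpr.1 _)) Opr.
rewrite (_ : (l + N == k)%N = false) ?mul0r ?mulr0 ?subr0; last by apply/eqP; lia.
have [psi1 bpsi] := Upsi k.
rewrite -prhE (biorthogonal_below Lprh Oprh) //; last exact: cmv_below_widen bpsi.
have [<-|ne_k] := eqVneq k l; first by rewrite psi1 conjC1.
by rewrite mul0r bpsi ?conjC0 ?mul0r // ltn_neqAle ne_k.
Qed.

Let h_quasidet theta : scalar theta -> jet_mx N s phi l \in unitmx ->
  theta h = ext_coef M n l *
    quasidet (jet_mx N s phi l) (\col_(i < N) theta (phi (l + i)%N))
      (jet_row N s (phi (l + N)%N)) 0.
Proof.
move=> lin uA.
have Oh k : (k < l)%N -> pr h (psi k) = 0.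
  by move=> lt_k; rewrite pr_h ?ltn_eqF ?mul0r // ltnW.
rewrite (residual_quasidet Lpr Opr Uphi H_neq0 zM Mphih h_below Oh lin uA).
by rewrite /quasidet /r linearZ -!scalemxAl mxE !sub0r mulrN.
Qed.

(** [theta] is evaluation at [z]; the term [r] supplies the corner entry of the
    quasideterminant. *)
Lemma christoffel_first z : z != 0 -> jet_mx N s phi l \in unitmx ->
    leval M z != 0 ->
  leval (phih l) z = ext_coef M n l / leval M z *
    quasidet (jet_mx N s phi l) (\col_(i < N) leval (phi (l + i)%N) z)
      (jet_row N s (phi (l + N)%N)) (leval (phi (l + N)%N) z).
Proof.
move=> z0 uA Mz0; apply: (mulfI Mz0); rewrite -leval_lmul // Mphih levalD.
rewrite (h_quasidet (leval_scalar z)) // /r (scalarZ _ _ (leval_scalar z)).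
by rewrite -mulrDr mulrA [leval M z * _]mulrC divfK // /quasidet sub0r.
Qed.

(** [theta] is pairing with [psi l] divided by [H l]: it sends [phi (l + i)] to the
    [i]-th entry of the first unit vector, and [M phih_l] to the ratio of the new
    norm to the old one. *)
Lemma christoffel_norm : jet_mx N s phi l \in unitmx ->
  Hh l = ext_coef M n l * H l *
    quasidet (jet_mx N s phi l) (\col_(i < N) (i == 0%N :> nat)%:R)
      (jet_row N s (phi (l + N)%N)) 0.
Proof.
move=> uA; pose theta f := pr f (psi l) / H l.
have lin : scalar theta.
  by move=> c f g; rewrite /theta (Lpr.1 _ c f g) mulrDl mulrA.
have := h_quasidet lin uA; rewrite {1}/theta pr_h // eqxx mul1r.
move=> /(canRL (divfK (H_neq0 l))) ->; rewrite mulrAC; congr (_ * quasidet _ _ _ _).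
apply/colP => i; rewrite !mxE /theta Opr -[X in (_ == X)%N]addn0 eqn_add2l.
by case: eqP => [->|_]; rewrite ?mul0r // addn0 mul1r divff.
Qed.

End FirstFamily.

(** Here [p] and [r] are the two reproducing kernels and [theta] is the coefficient
    at position [l + N].  By triangularity it vanishes on [phi (l + 1 + i)] for
    [i < N - 1] and is [1] for [i = N - 1]; on [M p] it is [ext_coef M n l] times
    the leading coefficient of [p], namely the conjugate of [psih l] at [z]
    divided by [Hh l]. *)
Lemma christoffel_second l z : jet_mx N s phi l.+1 \in unitmx ->
  (leval (psih l) z)^* = Hh l / ext_coef M n l *
    quasidet (jet_mx N s phi l.+1) (\col_(i < N) (i == N.-1 :> nat)%:R)
      (jet_row N s (reproducing_kernel phi psi H l.+1 z)) 0.
Proof.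
move=> uA; pose r := reproducing_kernel phi psi H l.+1 z.
pose p := reproducing_kernel phih psih Hh l.+1 z; pose h := lmul M p - r.
have Mp : lmul M p = r + h by rewrite addrC subrK.
have bp : cmv_below l.+1 p by exact: reproducing_kernel_below.
have br : cmv_below l.+1 r by exact: reproducing_kernel_below.
have bh : cmv_below (l.+1 + N) h.
  rewrite /h -scaleN1r; apply: cmv_belowD; first exact: cmv_below_lmul.
  by apply: cmv_belowZ; apply: cmv_below_widen br; rewrite leq_addr.
have Oh k : (k < l.+1)%N -> pr h (psi k) = 0.
  move=> lt_k; have bpsi : cmv_below l.+1 (psi k).
    by apply: cmv_below_widen (proj2 (Upsi k)).
  rewrite (scalarB _ _ (Lpr.1 _)) /= -prhE.
  rewrite (reproducing_kernelP Lprh Oprh Upsih Hh_neq0) //.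
  by rewrite (reproducing_kernelP Lpr Opr Upsi H_neq0) // subrr.
have lin : scalar (mcoeff (chi_exp (l + N)) : laurent C -> C).
  by move=> c f g; rewrite mcoeffD mcoeffZ.
have := residual_quasidet Lpr Opr Uphi H_neq0 zM Mp bh Oh lin uA.
rewrite {1}/h mcoeffB br; last by lia.
rewrite coef_lmul_top // subr0 /p /reproducing_kernel.
rewrite (coef_unitri_sum _ (fun k => (leval (psih k) z)^* * (Hh k)^-1)) //.
have -> : \col_(i < N) (phi (l.+1 + i)%N)@_(chi_exp (l + N)) =
          \col_(i < N) (i == N.-1 :> nat)%:R :> 'cV[C]_N.
  apply/colP => i; rewrite !mxE; have [phi1 bphi] := Uphi (l.+1 + i)%N.
  have lt_i := ltn_ord i; case: eqP => [iN|ne_i].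
    by rewrite (_ : l + N = l.+1 + i)%N //; lia.
  by rewrite bphi //; lia.
move=> <-; rewrite mulrC; field.
by rewrite ext_coef_neq0 Hh_neq0.
Qed.

End Perturbed.

End Forms.

(** * Passing to the adjoint form *)

Section Duality.
Variable C : numClosedFieldType.
Implicit Types (f g M : laurent C) (u : laurent C -> C).
Implicit Types (pr : laurent C -> laurent C -> C).

Definition adjoint_form pr f g := (pr g f)^*.

Lemma adjoint_sesquilinear pr : sesquilinear pr -> sesquilinear (adjoint_form pr).
Proof.
case=> linl linr; split=> [//|f c g h]; rewrite /adjoint_form !conjCK.
exact: linl.
Qed.

Lemma adjoint_biorthogonal pr phi psi H : biorthogonal pr phi psi H ->
  biorthogonal (adjoint_form pr) psi phi (fun k => (H k)^*).
Proof.
move=> Opr j k; rewrite /adjoint_form Opr rmorphM rmorph_nat eq_sym.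
by case: eqP => [->|_] //; rewrite !mul0r.
Qed.

Lemma pairing_sesquilinear u : scalar u -> sesquilinear (pairing u).
Proof.
move=> lin; split=> [g c f h|f c g h]; rewrite /pairing.
  by rewrite ![lmul _ (lstar g)]lmulC linearP /= lin.
by rewrite lstarD lstarZ linearP /= lin rmorphD rmorphM /= conjCK.
Qed.

Lemma perturb_scalar M u : scalar u -> scalar (perturb M u).
Proof. by move=> lin c f g; rewrite /perturb linearP /= lin. Qed.

Lemma pairing_perturbl M u f g : pairing (perturb M u) f g = pairing u (lmul M f) g.
Proof. by rewrite /pairing /perturb lmulA. Qed.

(** On the unit circle, multiplication by [lstar M] is the adjoint of
    multiplication by [M]; this makes the adjoint form satisfy the same
    perturbation hypothesis as the form itself. *)
Lemma pairing_perturbr M u f g :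
  pairing (perturb M u) f g = pairing u f (lmul (lstar M) g).
Proof. by rewrite /pairing /perturb lstar_lmul lstarK !lmulA (lmulC M). Qed.

Lemma prepared_lstar n M : prepared n M -> prepared n (lstar M).
Proof.
case=> n_gt0 suppM ext; split=> // [k lt_k|].
  by rewrite coef_lstar suppM ?conjC0 // normrN.
by rewrite !coef_lstar opprK -rmorphM conjC_eq0 mulrC.
Qed.

Lemma ext_coef_lstar n M a : ext_coef (lstar M) n a = (ext_coef M n a.+1)^*.
Proof. by rewrite /ext_coef coef_lstar exprS mulN1r mulNr. Qed.

Lemma cd_kernel_conjE (S1 S2 : infmx C) H l z :
  cd_kernel_conj S1 S2 H l z =
    reproducing_kernel (cmv_poly S2) (cmv_poly S1) (fun k => (H k)^*) l z.
Proof. by apply: eq_bigr => k _; rewrite fmorphV mulrC. Qed.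

End Duality.

(** * The Christoffel formulas *)

Theorem proposition12 (R : realType) (n : nat)
    (u : {scalar laurent R[i]}) (L : laurent R[i])
    (hL : prepared n L)
    (hu : quasidefinite (gram u))
    (huL : quasidefinite (gram (perturb L u)))
    (S1 S2 : infmx R[i]) (H : nat -> R[i])
    (hS : gauss_borel (gram u) S1 S2 H)
    (S1h S2h : infmx R[i]) (Hh : nat -> R[i])
    (hSh : gauss_borel (gram (perturb L u)) S1h S2h Hh)
    (s : seq (R[i] * nat)) (hs : zeros_mult L s)
    (ss : seq (R[i] * nat)) (hss : zeros_mult (lstar L) ss)
    (l : nat) (hl : (2 * n <= l)%N) :
  let N := (2 * n)%N in
  let phi1 := cmv_poly S1 in
  let phi2 := cmv_poly S2 in
  let phi1h := cmv_poly S1h in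
  let phi2h := cmv_poly S2h in
  (* the 2n x 2n blocks with rows J^L phi_{1,a}, ..., J^L phi_{1,a+2n-1},
     resp. J^{L_*} phi_{2,a}, ..., J^{L_*} phi_{2,a+2n-1} *)
  let A1 := fun a : nat => jet_mx N s phi1 a in
  let A2 := fun a : nat => jet_mx N ss phi2 a in
  let e_first : 'cV[R[i]]_N := \col_(i < N) (i == 0%N :> nat)%:R in
  let e_last : 'cV[R[i]]_N := \col_(i < N) (i == N.-1 :> nat)%:R in
  [/\ (forall z : R[i], z != 0 ->
        (A1 l \in unitmx -> leval L z != 0 ->
          leval (phi1h l) z =
            ext_coef L n l / leval L z *
            quasidet (A1 l) (\col_(i < N) leval (phi1 (l + i)%N) z)
              (jet_row N s (phi1 (l + N)%N)) (leval (phi1 (l + N)%N) z))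
        /\
        (A2 l.+1 \in unitmx ->
          leval (phi1h l) z =
            ((Hh l)^* / (ext_coef L n l.+1)^* *
             quasidet (A2 l.+1) e_last
               (jet_row N ss (cd_kernel_conj S1 S2 H l.+1 z)) 0)^*)),
      ((A1 l \in unitmx ->
          Hh l = ext_coef L n l * H l *
            quasidet (A1 l) e_first (jet_row N s (phi1 (l + N)%N)) 0)
        /\
        (A2 l \in unitmx ->
          Hh l =
            ((ext_coef L n l.+1)^* * (H l)^* *
             quasidet (A2 l) e_first (jet_row N ss (phi2 (l + N)%N)) 0)^*))
    & (forall z : R[i], z != 0 ->
        (A1 l.+1 \in unitmx ->
          (leval (phi2h l) z)^* =
            Hh l / ext_coef L n l *
            quasidet (A1 l.+1) e_last
              (jet_row N s (cd_kernel S1 S2 H l.+1 z)) 0)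
        /\
        (A2 l \in unitmx -> leval (lstar L) z != 0 ->
          (leval (phi2h l) z)^* =
            ((ext_coef L n l.+1)^* / leval (lstar L) z *
             quasidet (A2 l) (\col_(i < N) leval (phi2 (l + i)%N) z)
               (jet_row N ss (phi2 (l + N)%N)) (leval (phi2 (l + N)%N) z))^*))].
Proof.
move=> N phi1 phi2 phi1h phi2h A1 A2 e_first e_last.
have linu : scalar u by move=> c f g; rewrite linearP.
have Lpr := pairing_sesquilinear linu.
have Lprh := pairing_sesquilinear (perturb_scalar L linu).
have Opr := gauss_borel_biorthogonal Lpr hS.
have Oprh := gauss_borel_biorthogonal Lprh hSh.
have [US1 US2 H0 _] := hS; have [US1h US2h Hh0 _] := hSh.
have U1 := cmv_poly_unitri US1; have U2 := cmv_poly_unitri US2.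
have U1h := cmv_poly_unitri US1h; have U2h := cmv_poly_unitri US2h.
have aLpr := adjoint_sesquilinear Lpr; have aLprh := adjoint_sesquilinear Lprh.
have aOpr := adjoint_biorthogonal Opr; have aOprh := adjoint_biorthogonal Oprh.
have aH0 k : (H k)^* != 0 by rewrite conjC_eq0.
have aHh0 k : (Hh k)^* != 0 by rewrite conjC_eq0.
have pertE := pairing_perturbl L u.
have apertE f g : adjoint_form (pairing (perturb L u)) f g =
    adjoint_form (pairing u) (lmul (lstar L) f) g.
  by rewrite /adjoint_form pairing_perturbr.
have hLs := prepared_lstar hL.
split=> [z z0||z z0]; split.
- exact: (christoffel_first Lpr Opr U1 U2 H0 Lprh Oprh U1h U2h hL pertE hs).
- move=> uA; rewrite cd_kernel_conjE -ext_coef_lstar.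
  by rewrite -(christoffel_second aLpr aOpr U2 U1 aH0 aLprh aOprh U2h U1h aHh0
                hLs apertE hss) // conjCK.
- exact: (christoffel_norm Lpr Opr U1 U2 H0 Lprh Oprh U1h U2h hL pertE hs).
- move=> uA; rewrite -ext_coef_lstar.
  by rewrite -(christoffel_norm aLpr aOpr U2 U1 aH0 aLprh aOprh U2h U1h
                hLs apertE hss) // conjCK.
- exact: (christoffel_second Lpr Opr U1 U2 H0 Lprh Oprh U1h U2h Hh0 hL pertE hs).
- move=> uA Lz0; rewrite -ext_coef_lstar; congr (_^*).
  exact: (christoffel_first aLpr aOpr U2 U1 aH0 aLprh aOprh U2h U1h hLs apertE hss).
Qed.
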